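(* Let $n\ge 2$, let $U\subset\mathbb{R}^n$ be open, and let $F=(f_1,\dots,f_n)^t:U\to\mathbb{R}^n$ be a $C^\infty$ vector field with Jacobian matrix $J(X)$, defining the system $\frac{dX}{dt}=F(X)$ with velocity $V=F(X)$. Assume that $J$ is stationary, i.e. $\frac{dJ}{dt}=0$ along trajectories (equivalently $\sum_{k} f_k\,\frac{\partial J}{\partial x_k}\equiv 0$ on $U$). Let $X\in U$ be a point at which $J(X)$ has a basis of eigenvectors $Y_{\lambda_1},\dots,Y_{\lambda_n}$ of $\mathbb{C}^n$, with eigenvalues $\lambda_1,\dots,\lambda_n$, where $\lambda_1$ is the fast eigenvalue (the one with largest absolute value of the real part). If $X$ satisfies the slow manifold equation of the generalized tangent linear system approximation, $$V\cdot\left(Y_{\lambda_2}\wedge\cdots\wedge Y_{\lambda_n}\right)=0,\quad\text{i.e. } V=\sum_{i=2}^n a_iY_{\lambda_i}\ \text{for some coefficients } a_i,$$ then $X$ satisfies the flow curvature equation $$\dot X\cdot\left(\ddot X\wedge\dddot X\wedge\cdots\wedge X^{(n)}\right)=0 .$$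
   Context: The notation $a_1\cdot(a_2\wedge\cdots\wedge a_n)$ means $\det(a_1,\dots,a_n)$. $X^{(k)}$ denotes the $k$-th time derivative at the point $X$ of the trajectory through $X$: $\dot X=V=F(X)$, and $X^{(k+1)}$ is obtained from $X^{(k)}$ by applying $\sum_i f_i\,\partial/\partial x_i$ componentwise. *)

(* Defs.v *)
From HB Require Import structures.
From mathcomp Require Import all_boot all_order all_algebra.
From mathcomp Require Export complex.
From mathcomp Require Import all_classical all_reals all_analysis.
Import Order.TTheory GRing.Theory Num.Theory.
Import numFieldNormedType.Exports.
Set Implicit Arguments.
Unset Strict Implicit.
Unset Printing Implicit Defensive.
Local Open Scope classical_set_scope.
Local Open Scope ring_scope.

(* Points and vectors are row vectors, as in the library's [jacobian]:
   [jacobian F x i j] is the partial derivative of f_j with respect to x_i, so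
   [v *m jacobian F x] is the row-vector form of J(x) v and an eigenvector Y of
   J(x) satisfies [Y *m jacobian F x = lambda *: Y]. *)

(* C^k on the open set U. For k > 0, [f] is required to be (Frechet)
   differentiable on U with C^(k-1) partial derivatives, which is equivalent to
   the existence and continuity on U of all partial derivatives of order <= k. *)
Fixpoint Ck_on (R : realType) (n : nat) (W : normedModType R)
    (U : set 'rV[R]_n) (k : nat) (f : 'rV[R]_n -> W) : Prop :=
  match k with
  | 0 => forall x, U x -> {for x, continuous f}
  | k'.+1 => (forall x, U x -> differentiable f x) /\
             (forall i : 'I_n, Ck_on U k' (fun x => 'D_(delta_mx 0 i) f x))
  end.

Definition smooth_on (R : realType) (n : nat) (W : normedModType R)
    (U : set 'rV[R]_n) (f : 'rV[R]_n -> W) : Prop :=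
  forall k : nat, Ck_on U k f.

(* sum_i f_i d/dx_i, the time derivative of [g] along the trajectories of
   dX/dt = F(X). *)
Definition ddt (R : realType) (n : nat) (F : 'rV[R]_n -> 'rV[R]_n)
    (g : 'rV[R]_n -> R) (x : 'rV[R]_n) : R :=
  \sum_(i < n) F x 0 i * 'D_(delta_mx 0 i) g x.

Definition ddt_vec (R : realType) (n : nat) (F G : 'rV[R]_n -> 'rV[R]_n)
    (x : 'rV[R]_n) : 'rV[R]_n :=
  \row_(j < n) ddt F (fun y => G y 0 j) x.

(* X^(k) as a function of the point X: X^(0) = X, X^(1) = F(X), and
   X^(k+1) is the componentwise time derivative of X^(k). *)
Definition traj_deriv (R : realType) (n : nat) (F : 'rV[R]_n -> 'rV[R]_n)
    (k : nat) : 'rV[R]_n -> 'rV[R]_n :=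
  if k is k'.+1 then iter k' (ddt_vec F) F else id.

Definition stationary_jacobian (R : realType) (n : nat) (U : set 'rV[R]_n)
    (F : 'rV[R]_n -> 'rV[R]_n) : Prop :=
  forall x, U x -> forall i j : 'I_n, ddt F (fun y => jacobian F y i j) x = 0.

(* a_1 . (a_2 /\ ... /\ a_n) = det(a_1, ..., a_n); the a_i are the rows of the
   matrix, which does not change the determinant. *)
Definition dot_wedge (K : comNzRingType) (n : nat) (a : 'I_n -> 'rV[K]_n) : K :=
  \det (\matrix_(i < n) a i).

Definition complexify (R : realType) (m n : nat) (A : 'M[R]_(m, n)) :
    'M[R[i]]_(m, n) :=
  map_mx (real_complex R) A.

(* Main.v *)
Require Import Defs.
From mathcomp Require Import all_boot all_order all_algebra.
From mathcomp Require Import all_classical all_reals all_analysis.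
Import Order.TTheory GRing.Theory Num.Theory.
Import numFieldNormedType.Exports.
Set Implicit Arguments.
Unset Strict Implicit.
Unset Printing Implicit Defensive.
Local Open Scope classical_set_scope.
Local Open Scope ring_scope.

(** Both vanishing determinants express that a single column vector is annihilated by
    all the rows. The rows V, Y_2, ..., Y_n are dependent, so some w <> 0 satisfies
    V w = 0 and Y_i w = 0 for i >= 2. Up to scaling, w is the linear form dual to Y_1
    in the eigenbasis; hence it is an eigenvector of J on the other side, J w =
    lambda_1 w ([slow_covector]). It follows that V J^k w = lambda_1^k V w = 0 for
    every k, so the rows V, V J, ..., V J^(n-1) are dependent as well
    ([dot_wedge_iter_eq0]).

    Stationarity of J makes these rows the derivatives of the trajectory: the chain
    rule gives X'' = V J, and differentiating V J^k only differentiates V, because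
    dJ/dt = 0, so that X^(k+1) = V J^k on the whole of U ([traj_deriv_stationary]).
    The determinant of these real vectors is then computed over the complex numbers,
    where w lives. *)

(** * Linear algebra *)

Lemma det_eq0_kernel (K : fieldType) (n : nat) (A : 'M[K]_n) :
  \det A = 0 <-> exists2 w : 'cV[K]_n, w != 0 & A *m w = 0.
Proof.
rewrite -det_tr; split=> [/eqP/det0P[v v0 vA]|[w w0 Aw]].
- exists v^T; first by rewrite trmx_eq0.
  by apply: trmx_inj; rewrite trmx_mul trmxK vA trmx0.
- apply/eqP/det0P; exists w^T; first by rewrite trmx_eq0.
  by rewrite -trmx_mul Aw trmx0.
Qed.

(** The vector w in the kernel of the slow determinant is dual to Y_i1; the eigenvector
    equation for J on columns is tested against the eigenbasis. *)
Lemma slow_covector (K : fieldType) (n : nat) (J : 'M[K]_n)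
    (Y : 'I_n -> 'rV[K]_n) (lambda : 'I_n -> K) (i1 : 'I_n) (V : 'rV[K]_n) :
  row_free (\matrix_(i < n) Y i) ->
  (forall i, Y i *m J = lambda i *: Y i) ->
  dot_wedge (fun i => if i == i1 then V else Y i) = 0 ->
  exists2 w : 'cV[K]_n, w != 0 & V *m w = 0 /\ J *m w = lambda i1 *: w.
Proof.
move=> Yfree YJ /det_eq0_kernel[w w0 Mw]; exists w => //.
have rowMw i : (if i == i1 then V else Y i) *m w = 0.
  by rewrite -[X in X *m w](rowK (fun i => if i == i1 then V else Y i))
             -row_mul Mw row0.
split; first by have := rowMw i1; rewrite eqxx.
have Yinj : injective (mulmx (\matrix_(i < n) Y i) : 'cV[K]_n -> 'cV[K]_n).
  by apply: can_inj (mulKmx _); rewrite -row_free_unit.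
apply: Yinj; apply/row_matrixP => i; rewrite !row_mul !rowK mulmxA YJ.
(* For i <> i1 both sides pair to 0 with Y_i; for i = i1 they agree by the eigenvalue
   equation. *)
rewrite -scalemxAl -scalemxAr; have [-> //|ii1] := eqVneq i i1.
by have := rowMw i; rewrite (negbTE ii1) => ->; rewrite !scaler0.
Qed.

(** The hyperplane of rows annihilated by w contains V and is stable under J, so it
    contains all the iterates of V. *)
Lemma dot_wedge_iter_eq0 (K : fieldType) (n : nat) (J : 'M[K]_n)
    (V : 'rV[K]_n) (mu : K) (w : 'cV[K]_n) :
  w != 0 -> V *m w = 0 -> J *m w = mu *: w ->
  dot_wedge (fun i : 'I_n => iter i (mulmxr J) V) = 0.
Proof.
move=> w0 Vw Jw; apply/det_eq0_kernel; exists w => //.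
apply/row_matrixP => i; rewrite row_mul rowK row0.
elim: (i : nat) => [//|k IH] /=.
by rewrite -mulmxA Jw -scalemxAr IH scaler0.
Qed.

(** * Time derivatives along trajectories *)

Section Trajectory.
Variables (R : realType) (n : nat).
Implicit Types (F G : 'rV[R]_n -> 'rV[R]_n) (g h : 'rV[R]_n -> R).
Implicit Types (x : 'rV[R]_n) (U : set 'rV[R]_n).

(** The derivability notion matching [ddt], which is a combination of partial
    derivatives; it is inherited by coordinates, sums and products. *)
Definition partially_derivable g x :=
  forall i : 'I_n, derivable g x (delta_mx 0 i).

(** Formulas for [jacobian F] and for the iterated time derivatives are available on U
    only, whereas [ddt] differentiates functions given on the whole space. *)
Lemma ddt_germ F U g h x : open U -> U x ->
  (forall y, U y -> g y = h y) -> ddt F g x = ddt F h x.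
Proof.
move=> Uo Ux gh; apply: eq_bigr => i _; congr (_ * _).
apply: near_eq_derive.
by apply: filterS (open_nbhs_nbhs (conj Uo Ux)) => y /gh.
Qed.

Lemma partially_derivable_germ U g h x : open U -> U x ->
  (forall y, U y -> g y = h y) ->
  partially_derivable g x -> partially_derivable h x.
Proof.
move=> Uo Ux gh dg i.
apply: near_eq_derivable (dg i).
by apply: filterS (open_nbhs_nbhs (conj Uo Ux)) => y /gh.
Qed.

Lemma partially_derivable_sum_mul m (a b : 'I_m -> 'rV[R]_n -> R) x :
  (forall l, partially_derivable (a l) x) ->
  (forall l, partially_derivable (b l) x) ->
  partially_derivable (fun y => \sum_(l < m) a l y * b l y) x.
Proof.
move=> da db i.
have -> : (fun y => \sum_(l < m) a l y * b l y) = \sum_(l < m) (a l * b l).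
  by apply/funext => y; rewrite fct_sumE.
by apply: derivable_sum => l; apply: derivableM; [exact: da|exact: db].
Qed.

Lemma ddt_sum_mul F m (a b : 'I_m -> 'rV[R]_n -> R) x :
  (forall l, partially_derivable (a l) x) ->
  (forall l, partially_derivable (b l) x) ->
  ddt F (fun y => \sum_(l < m) a l y * b l y) x =
  \sum_(l < m) (a l x * ddt F (b l) x + b l x * ddt F (a l) x).
Proof.
move=> da db; rewrite /ddt.
have -> : (fun y => \sum_(l < m) a l y * b l y) = \sum_(l < m) (a l * b l).
  by apply/funext => y; rewrite fct_sumE.
transitivity (\sum_(i < n) \sum_(l < m)
    (a l x * (F x 0 i * 'D_(delta_mx 0 i) (b l) x) +
     b l x * (F x 0 i * 'D_(delta_mx 0 i) (a l) x))).
  apply: eq_bigr => i _; rewrite derive_sum; last first.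
    by move=> l; apply: derivableM; [exact: da|exact: db].
  rewrite mulr_sumr; apply: eq_bigr => l _; rewrite deriveM; [|exact: da|exact: db].
  by rewrite mulrDr; congr (_ + _); exact: mulrCA.
rewrite exchange_big; apply: eq_bigr => l _.
by rewrite big_split /= !mulr_sumr.
Qed.

Lemma jacobian_coord F x (i j : 'I_n) : differentiable F x ->
  jacobian F x i j = 'D_(delta_mx 0 i) F x 0 j.
Proof. by move=> dF; rewrite deriveEjacobian // -rowE [RHS]mxE. Qed.

Lemma differentiable_coord_derivable G x (j : 'I_n) : differentiable G x ->
  partially_derivable (fun y => G y 0 j) x.
Proof.
move=> dG i.
by have /derivable_mxP := diff_derivable (v := delta_mx 0 i) dG; exact.
Qed.

(** The chain rule along a trajectory: the acceleration is V J. *)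
Lemma ddt_coord F x (j : 'I_n) : differentiable F x ->
  ddt F (fun y => F y 0 j) x = (F x *m jacobian F x) 0 j.
Proof.
move=> dF; rewrite mxE; apply: eq_bigr => i _; congr (_ * _).
rewrite jacobian_coord // derive_mx ?mxE //; exact: diff_derivable.
Qed.

(** The entries of the Jacobian matrix agree on U with the coordinates of the partial
    derivatives of F, which are differentiable since F is twice differentiable. *)
Lemma jacobian_derivable U F x (i j : 'I_n) : open U -> smooth_on U F -> U x ->
  partially_derivable (fun y => jacobian F y i j) x.
Proof.
move=> Uo Fsm Ux; have [dF dDF] := Fsm 2%N.
apply: (@partially_derivable_germ U (fun y => 'D_(delta_mx 0 i) F y 0 j)) => //.
  by move=> y /dF/jacobian_coord ->.
by apply: differentiable_coord_derivable; have [+ _] := dDF i; apply.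
Qed.

(** The field V J^k; J is applied one factor at a time, so that square matrices of an
    arbitrary, possibly zero, size need no ring structure. *)
Definition jacobian_iterate F k x := iter k (mulmxr (jacobian F x)) (F x).

Lemma jacobian_iterate_derivable U F k x (j : 'I_n) :
  open U -> smooth_on U F -> U x ->
  partially_derivable (fun y => jacobian_iterate F k y 0 j) x.
Proof.
move=> Uo Fsm; elim: k x j => [|k IH] x j Ux.
  by apply: differentiable_coord_derivable; have [+ _] := Fsm 1%N; apply.
apply: (@partially_derivable_germ U
  (fun y => \sum_l jacobian_iterate F k y 0 l * jacobian F y l j)) => //.
  by move=> y Uy; rewrite /= mxE.
apply: (@partially_derivable_sum_mul n (fun l y => jacobian_iterate F k y 0 l)
          (fun l y => jacobian F y l j)) => l; first exact: IH.
exact: (@jacobian_derivable U).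
Qed.

(** By the product rule d(V J^k J)/dt = (d(V J^k)/dt) J + V J^k (dJ/dt), whose second
    term vanishes by stationarity. *)
Lemma ddt_jacobian_iterate U F k x :
  open U -> smooth_on U F -> stationary_jacobian U F -> U x ->
  ddt_vec F (jacobian_iterate F k) x = jacobian_iterate F k.+1 x.
Proof.
move=> Uo Fsm FJ; elim: k x => [|k IH] x Ux; apply/rowP => j; rewrite mxE.
  by apply: ddt_coord; have [+ _] := Fsm 1%N; apply.
have -> : (fun y => jacobian_iterate F k.+1 y 0 j) =
          (fun y => \sum_l jacobian_iterate F k y 0 l * jacobian F y l j).
  by apply/funext => y; rewrite /= mxE.
rewrite (@ddt_sum_mul F n (fun l y => jacobian_iterate F k y 0 l)
           (fun l y => jacobian F y l j)); first last.
- by move=> l; exact: (@jacobian_derivable U).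
- by move=> l; exact: (@jacobian_iterate_derivable U).
rewrite [RHS]mxE; apply: eq_bigr => l _.
rewrite FJ // mulr0 add0r mulrC; congr (_ * _).
by have /rowP/(_ l) := IH x Ux; rewrite mxE.
Qed.

(** The equality holds on all of U, and not merely at one point, since the induction
    step differentiates it. *)
Lemma traj_deriv_stationary U F k x :
  open U -> smooth_on U F -> stationary_jacobian U F -> U x ->
  traj_deriv F k.+1 x = jacobian_iterate F k x.
Proof.
move=> Uo Fsm FJ; elim: k x => [//|k IH] x Ux.
rewrite -(@ddt_jacobian_iterate U) //; apply/rowP => j; rewrite !mxE.
by apply: (@ddt_germ F U) => // y Uy; rewrite -IH.
Qed.

End Trajectory.

Theorem mainTheorem3 (R : realType) (n : nat) (hn : (2 <= n)%N)
  (U : set 'rV[R]_n) (hU : open U)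
  (F : 'rV[R]_n -> 'rV[R]_n) (hF : smooth_on U F)
  (hJ : stationary_jacobian U F)
  (X : 'rV[R]_n) (hX : U X)
  (Y : 'I_n -> 'rV[R[i]]_n) (lambda : 'I_n -> R[i])
  (hbasis : row_free (\matrix_(i < n) Y i))
  (heigen : forall i : 'I_n,
      Y i *m complexify (jacobian F X) = lambda i *: Y i)
  (* the first index, i.e. that of lambda_1 *)
  (i1 : 'I_n) (hi1 : i1 = 0%N :> nat)
  (hfast : forall i : 'I_n,
      `|complex.Re (lambda i)| <= `|complex.Re (lambda i1)|)
  (hslow : dot_wedge
      (fun i : 'I_n => if i == i1 then complexify (F X) else Y i) = 0) :
  dot_wedge (fun i : 'I_n => traj_deriv F i.+1 X) = 0.
Proof.
have [w w0 [Vw Jw]] := slow_covector hbasis heigen hslow.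
(* The determinant is real, but the vector w is complex: the vanishing is transferred
   along the injection of the reals into the complex numbers. *)
have := dot_wedge_iter_eq0 w0 Vw Jw.
rewrite /dot_wedge => detC; apply: (fmorph_inj (real_complex R)).
rewrite rmorph0 -det_map_mx -{}[RHS]detC; congr (\det _).
apply/row_matrixP => i; rewrite -map_row !rowK (@traj_deriv_stationary _ _ U) //.
elim: (i : nat) => [//|k IH]; by rewrite /= map_mxM IH.
Qed.
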